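(* Let $R$ be a commutative ring containing a field of positive characteristic $p$, and let $X_{\mathrm{frob}}=\operatorname{Spec} R$ be endowed with the Frobenius topology. (1) Let $0\to N\to M\to L\to0$ be a short exact sequence of $R$-modules with corresponding short exact sequence of sheaves $0\to N^{\mathrm{frob}}\to M_{\mathrm{frob}}\to L_{\mathrm{frob}}\to0$ on $X_{\mathrm{frob}}$, where $N^{\mathrm{frob}}=\ker(M_{\mathrm{frob}}\to L_{\mathrm{frob}})$. Then $H^1(X_{\mathrm{frob}},N^{\mathrm{frob}})=0$. (2) Let $N\subseteq M$ be finitely generated $R$-modules and let $R^n\to M$ be an $R$-module homomorphism with image $N$. Let $\mathrm{Syz}$ be the kernel sheaf of the induced sheaf morphism $\mathcal O_{\mathrm{frob}}^n\to N^{\mathrm{frob}}\subseteq M_{\mathrm{frob}}$. Then $H^1(X_{\mathrm{frob}},\mathrm{Syz})=0$.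
   Context: For a scheme $U$ of characteristic $p$ let ${}^eU\to U$ be the $e$-th iterate of the absolute Frobenius morphism. A finite morphism $V\to U$ of finite type of schemes of characteristic $p$ is a finite Frobenius cover if there are $e\in\mathbb N$ and a factorization ${}^eU\to V\to U$ of the $e$-th iterate of the absolute Frobenius such that ${}^eU\to V$ is surjective. Frobenius topology on a scheme $X$ of characteristic $p$: the category consists of schemes over $X$ where all morphisms (including the structural morphisms to $X$) are finite Frobenius covers; each such single morphism is a covering. For an $R$-module $M$, $M_{\mathrm{frob}}$ is the sheafification of the presheaf $\operatorname{Spec} S\mapsto M\otimes_RS$, and $\mathcal O_{\mathrm{frob}}=R_{\mathrm{frob}}$. For $N\subseteq M$, $N^{\mathrm{frob}}$ denotes the image sheaf of $N_{\mathrm{frob}}\to M_{\mathrm{frob}}$ (by right exactness of sheafification it equals the kernel of $M_{\mathrm{frob}}\to(M/N)_{\mathrm{frob}}$). $H^1$ is derived functor cohomology of the global section functor on abelian sheaves on $X_{\mathrm{frob}}$. *)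

(* Defs.v *)
From HB Require Import structures.
From mathcomp Require Import all_boot all_order all_algebra ring_quotient.
From mathcomp Require Import boolp.
From mathcomp Require Import freeg.

Set Implicit Arguments.
Unset Strict Implicit.
Unset Printing Implicit Defensive.
Import GRing.Theory.
Local Open Scope ring_scope.

Section Tensor.
Variables (R S : comNzRingType) (f : {rmorphism R -> S}) (M : lmodType R).

Notation free := {freeg (M * S)%type / int}.

Inductive balanced_rel : free -> Prop :=
| balanced_rel0 : balanced_rel 0
| balanced_relB x y : balanced_rel x -> balanced_rel y -> balanced_rel (x - y)
| balanced_relDl m m' s :
    balanced_rel (<< (m + m', s) >> - << (m, s) >> - << (m', s) >>)
| balanced_relDr m s s' :
    balanced_rel (<< (m, s + s') >> - << (m, s) >> - << (m, s') >>)
| balanced_relZ r m s :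
    balanced_rel (<< (r *: m, s) >> - << (m, f r * s) >>).

Definition balanced_relb (x : free) : bool := `[< balanced_rel x >].

Lemma balanced_relb_closed : zmod_closed balanced_relb.
Proof.
split=> [|x y]; first exact/asboolP/balanced_rel0.
move=> /asboolP hx /asboolP hy.
by apply/asboolP; apply: balanced_relB.
Qed.

Definition balanced_sub : zmodClosed free :=
  HB.pack balanced_relb
    (GRing.isZmodClosed.Build free balanced_relb balanced_relb_closed).

(* M (x)_R S: the free abelian group on M x S modulo the balancing relations. *)
Definition tensor : zmodType := Quotient.quot balanced_sub.
Definition tensor_pi (x : free) : tensor :=
  (\pi_(Quotient.quot balanced_sub) x)%qT.
Definition tens (m : M) (s : S) : tensor := tensor_pi << (m, s) >>.

Lemma tensor_piE x y : tensor_pi x = tensor_pi y <-> balanced_rel (x - y).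
Proof.
split=> [/eqP|h].
  by rewrite /tensor_pi -Quotient.idealrBE => /asboolP.
by apply/eqP; rewrite -(Quotient.idealrBE balanced_sub); apply/asboolP.
Qed.

Lemma tensor_piB : zmod_morphism tensor_pi.
Proof. by move=> x y; rewrite /tensor_pi !piE. Qed.

HB.instance Definition _ :=
  GRing.isZmodMorphism.Build free tensor tensor_pi tensor_piB.

Lemma tensDl m m' s : tens (m + m') s = tens m s + tens m' s.
Proof.
rewrite /tens -raddfD; apply/tensor_piE; rewrite opprD addrA.
exact: balanced_relDl.
Qed.

Lemma tensDr m s s' : tens m (s + s') = tens m s + tens m s'.
Proof.
rewrite /tens -raddfD; apply/tensor_piE; rewrite opprD addrA.
exact: balanced_relDr.
Qed.

Lemma tensZ r m s : tens (r *: m) s = tens m (f r * s).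
Proof. exact/tensor_piE/balanced_relZ. Qed.

Section Lift.
Variables (A : zmodType) (b : M -> S -> A).
Hypothesis bDl : forall m m' s, b (m + m') s = b m s + b m' s.
Hypothesis bDr : forall m s s', b m (s + s') = b m s + b m s'.
Hypothesis bZ : forall r m s, b (r *: m) s = b m (f r * s).

Let g (x : free) : A := fglift (fun y : M * S => b y.1 y.2 : zmodule A) x.

Let gB : zmod_morphism g.
Proof. exact: (@lift_is_additive int (M * S)%type (zmodule A)). Qed.

Let gU m s : g << (m, s) >> = b m s.
Proof. by rewrite /g liftU scale1r. Qed.

Let g_rel x : balanced_rel x -> g x = 0.
Proof.
pose G : {additive free -> A} := HB.pack g (GRing.isZmodMorphism.Build _ _ g gB).
rewrite -[g]/(G : _ -> _).
elim=> {x} [|x y _ hx _ hy|m m' s|m s s'|r m s].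
- exact: raddf0.
- by rewrite raddfB hx hy subrr.
- by rewrite !raddfB /= !gU bDl addrAC addrK subrr.
- by rewrite !raddfB /= !gU bDr addrAC addrK subrr.
- by rewrite raddfB /= !gU bZ subrr.
Qed.

Definition tensor_lift_fun (t : tensor) : A := g (repr t).

Lemma tensor_lift_pi x : tensor_lift_fun (tensor_pi x) = g x.
Proof.
apply/eqP; rewrite -subr_eq0 -gB; apply/eqP/g_rel/tensor_piE.
by rewrite /tensor_pi reprK.
Qed.

Lemma tensor_pi_surj (t : tensor) : exists x, t = tensor_pi x.
Proof. by exists (repr t); rewrite /tensor_pi reprK. Qed.

Lemma tensor_liftB : zmod_morphism tensor_lift_fun.
Proof.
move=> t t'; have [[x ->] [y ->]] := (tensor_pi_surj t, tensor_pi_surj t').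
by rewrite -raddfB !tensor_lift_pi gB.
Qed.

Definition tensor_lift : {additive tensor -> A} :=
  HB.pack tensor_lift_fun
    (GRing.isZmodMorphism.Build _ _ tensor_lift_fun tensor_liftB).

Lemma tensor_liftE m s : tensor_lift (tens m s) = b m s.
Proof. by rewrite [LHS]tensor_lift_pi gU. Qed.

End Lift.

Lemma tensor_ext (A : zmodType) (u v : {additive tensor -> A}) :
  (forall m s, u (tens m s) = v (tens m s)) -> u =1 v.
Proof.
move=> uv t; have [x ->] : exists x, t = tensor_pi x.
  by exists (repr t); rewrite /tensor_pi reprK.
rewrite -(freeg_sumE x) !raddf_sum; apply: eq_bigr => -[m s] _ /=.
have -> : << coeff (m, s) x *g (m, s) >> =
    << (m, s) >> *~ coeff (m, s) x :> free.
  by rewrite freegU_mulz intz.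
by rewrite !raddfMz; congr (_ *~ _); apply: uv.
Qed.

End Tensor.

Section TensorMap.
Variables (R S S' : comNzRingType) (f : {rmorphism R -> S}).
Variables (f' : {rmorphism R -> S'}) (M M' : lmodType R).
Variables (u : {linear M -> M'}) (v : {rmorphism S -> S'}).
Hypothesis vf : forall r, v (f r) = f' r.

Let b m s := tens f' (u m) (v s).

Let bDl m m' s : b (m + m') s = b m s + b m' s.
Proof. by rewrite /b raddfD tensDl. Qed.

Let bDr m s s' : b m (s + s') = b m s + b m s'.
Proof. by rewrite /b raddfD tensDr. Qed.

Let bZ r m s : b (r *: m) s = b m (f r * s).
Proof. by rewrite /b linearZ /= tensZ rmorphM /= vf. Qed.

Definition tensor_map : {additive tensor f M -> tensor f' M'} :=
  tensor_lift bDl bDr bZ.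

Lemma tensor_mapE m s : tensor_map (tens f m s) = tens f' (u m) (v s).
Proof. exact: tensor_liftE. Qed.

End TensorMap.

(* Ring homomorphisms [g : B -> A] stand for morphisms Spec A -> Spec B; the
   condition says that every point of Spec B is the image of one of Spec A. *)
Definition spec_surjective (A B : comNzRingType) (g : {rmorphism B -> A}) : Prop :=
  forall Q : {pred B}, idealr_closed Q -> prime_idealr_closed Q ->
  exists P : {pred A}, [/\ idealr_closed P, prime_idealr_closed P &
                           forall b, (b \in Q) = (g b \in P)].

Definition finite_rmorphism (A B : comNzRingType) (f : {rmorphism A -> B}) : Prop :=
  exists s : seq B, forall b, exists c : 'I_(size s) -> A,
    b = \sum_(i < size s) f (c i) * s`_i.

(* [f] stands for V = Spec B -> U = Spec A, and the factorization of the e-th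
   iterate of the absolute Frobenius of U through V for [g] : B -> A. *)
Definition finite_frobenius_cover (p : nat) (A B : comNzRingType)
    (f : {rmorphism A -> B}) : Prop :=
  finite_rmorphism f /\
  exists (e : nat) (g : {rmorphism B -> A}),
    (forall a, g (f a) = a ^+ (p ^ e)) /\ spec_surjective g.

Section FrobeniusSite.
Variable p : nat.

Lemma finite_frobenius_cover_id (A : comNzRingType) :
  finite_frobenius_cover p (idfun : {rmorphism A -> A}).
Proof.
split.
  by exists [:: 1] => b; exists (fun=> b); rewrite big_ord1 /= mulr1.
exists 0%N, idfun; split=> [a|Q Q0 Q1]; first by rewrite expn0 expr1.
by exists Q; split.
Qed.

Lemma finite_frobenius_cover_comp (A B C : comNzRingType)
    (f : {rmorphism A -> B}) (g : {rmorphism B -> C}) :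
  finite_frobenius_cover p f -> finite_frobenius_cover p g ->
  finite_frobenius_cover p (g \o f : {rmorphism A -> C}).
Proof.
move=> [[s sP] [e [f' [f'K f's]]]] [[t tP] [d [g' [g'K g's]]]]; split.
  exists [seq g x * y | x <- s, y <- t] => c.
  set st := [seq _ | _ <- _, _ <- _].
  pose spanned z := exists k : nat -> A, z = \sum_(i < size st) g (f (k i)) * st`_i.
  suff [k ->] : spanned c by exists (fun i => k i).
  have sp0 : spanned 0.
    by exists (fun=> 0); rewrite big1 // => i _; rewrite !rmorph0 mul0r.
  have spD x y : spanned x -> spanned y -> spanned (x + y).
    move=> [k ->] [l ->]; exists (fun i => k i + l i); rewrite -big_split.
    by apply: eq_bigr => i _; rewrite /= !rmorphD mulrDl.
  have spst a z : z \in st -> spanned (g (f a) * z).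
    move=> zst; exists (fun i => if i == index z st then a else 0).
    have iz : (index z st < size st)%N by rewrite index_mem.
    rewrite (bigD1 (Ordinal iz)) //= eqxx nth_index // big1 ?addr0 // => i.
    by rewrite -val_eqE /= => /negPf ->; rewrite !rmorph0 mul0r.
  have [k ->] := tP c; apply: big_ind => // j _.
  have [l ->] := sP (k j); rewrite rmorph_sum mulr_suml; apply: big_ind => // i _.
  rewrite rmorphM -mulrA; apply: spst; apply/allpairsP.
  by exists (s`_i, t`_j); rewrite !mem_nth.
exists (e + d)%N, (f' \o g' : {rmorphism C -> A}); split=> [a|Q Q0 Q1] /=.
  by rewrite g'K rmorphXn /= f'K -exprM -expnD.
have [P [P0 P1 QP]] := g's Q Q0 Q1; have [P' [P'0 P'1 PP']] := f's P P0 P1.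
by exists P'; split=> // b; rewrite QP PP'.
Qed.

(* A finite morphism to an affine scheme has affine source, so that the schemes
   over Spec R of the site are the spectra of finite R-algebras. *)
Variable R : comNzRingType.

Record site := SiteObj {
  site_ring :> comNzRingType;
  site_str : {rmorphism R -> site_ring};
  site_strP : finite_frobenius_cover p site_str
}.

(* [site_hom V U]: morphisms V -> U over Spec R, i.e. O(U) -> O(V). *)
Record site_hom (V U : site) := SiteHom {
  site_hom_fun :> {rmorphism U -> V};
  site_hom_over : forall r, site_hom_fun (site_str U r) = site_str V r;
  site_homP : finite_frobenius_cover p site_hom_fun
}.

Definition site_base : site := SiteObj (finite_frobenius_cover_id R).

Definition site_id (U : site) : site_hom U U :=
  @SiteHom U U idfun (fun=> erefl) (finite_frobenius_cover_id U).

Lemma site_comp_over (W V U : site) (a : site_hom V U) (b : site_hom W V) r :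
  (b \o a) (site_str U r) = site_str W r.
Proof. by rewrite /= !site_hom_over. Qed.

Definition site_comp (W V U : site) (a : site_hom V U) (b : site_hom W V) :
    site_hom W U :=
  @SiteHom W U (b \o a : {rmorphism U -> W}) (site_comp_over a b)
    (finite_frobenius_cover_comp (site_homP a) (site_homP b)).

End FrobeniusSite.

Section Sheaves.
Variables (p : nat) (R : comNzRingType).
Notation site := (site p R).
Notation X := (site_base p R).
Implicit Types U V W : site.

Record presheaf := Presheaf {
  sect :> site -> zmodType;
  restr : forall V U, site_hom V U -> {additive sect U -> sect V};
  restr_id : forall U x, restr (site_id U) x = x;
  restr_comp : forall W V U (a : site_hom V U) (b : site_hom W V) x,
    restr (site_comp a b) x = restr b (restr a x)
}.

(* Every single morphism a : V -> U of the site is a covering. The pairs (b, c)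
   below are the points of the fiber product of V with itself over U. *)
Definition matching (F : presheaf) V U (a : site_hom V U) (x : F V) : Prop :=
  forall W (b c : site_hom W V),
    site_comp a b = site_comp a c -> restr F b x = restr F c x.

Definition is_sheaf (F : presheaf) : Prop :=
  forall V U (a : site_hom V U) (x : F V), matching a x ->
  exists! y : F U, restr F a y = x.

Record sheaf := Sheaf { sheaf_val :> presheaf; sheafP : is_sheaf sheaf_val }.

Lemma restr_matching (F : presheaf) V U (a : site_hom V U) (y : F U) :
  matching a (restr F a y).
Proof. by move=> W b c bc; rewrite -!restr_comp bc. Qed.

Lemma restr_inj (F : sheaf) V U (a : site_hom V U) : injective (restr F a).
Proof.
move=> x y xy; have [z [_ zP]] := sheafP (restr_matching (a := a) x).
by rewrite -(zP x erefl) (zP y).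
Qed.

Record psh_hom (F G : presheaf) := PshHom {
  psh_hom_fun :> forall U, {additive F U -> G U};
  psh_hom_nat : forall V U (a : site_hom V U) x,
    psh_hom_fun V (restr F a x) = restr G a (psh_hom_fun U x)
}.

Lemma psh_comp_nat (F G H : presheaf) (u : psh_hom G H) (v : psh_hom F G)
    V U (a : site_hom V U) x :
  (u V \o v V) (restr F a x) = restr H a ((u U \o v U) x).
Proof. by rewrite /= !psh_hom_nat. Qed.

Definition psh_comp (F G H : presheaf) (u : psh_hom G H) (v : psh_hom F G) :
    psh_hom F H :=
  @PshHom F H (fun U => (u U \o v U : {additive F U -> H U})) (psh_comp_nat u v).

(* The universal morphism from F to a sheaf, i.e. the left adjoint to the inclusion
   of sheaves into presheaves evaluated at F. *)
Record sheafification (F : presheaf) := Sheafification {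
  shf :> sheaf;
  shf_unit : psh_hom F shf;
  shf_lift : forall G : sheaf, psh_hom F G -> psh_hom shf G;
  shf_liftE : forall (G : sheaf) (u : psh_hom F G) U x,
    shf_lift u U (shf_unit U x) = u U x;
  shf_lift_uniq : forall (G : sheaf) (u v : psh_hom shf G),
    (forall U x, u U (shf_unit U x) = v U (shf_unit U x)) ->
    forall U x, u U x = v U x
}.

Definition shf_map (F G : presheaf) (Fs : sheafification F) (Gs : sheafification G)
    (u : psh_hom F G) : psh_hom Fs Gs :=
  shf_lift Fs (psh_comp (shf_unit Gs) u).

Section Subsheaf.
Variable F : sheaf.

Record subsheaf := Subsheaf {
  sub_in :> forall U, F U -> Prop;
  sub_in0 : forall U, sub_in (0 : F U);
  sub_inB : forall U (x y : F U), sub_in x -> sub_in y -> sub_in (x - y);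
  sub_in_res : forall V U (a : site_hom V U) (x : F U),
    sub_in x -> sub_in (restr F a x);
  sub_in_local : forall V U (a : site_hom V U) (x : F U),
    sub_in (restr F a x) -> sub_in x
}.

Variable S : subsheaf.

Definition sub_inb U (x : F U) : bool := `[< S U x >].

Lemma sub_inb_closed U : zmod_closed (@sub_inb U).
Proof.
split=> [|x y]; first exact/asboolP/sub_in0.
by move=> /asboolP hx /asboolP hy; apply/asboolP/sub_inB.
Qed.

Definition sub_inc U : zmodClosed (F U) :=
  HB.pack (@sub_inb U) (GRing.isZmodClosed.Build (F U) (@sub_inb U) (@sub_inb_closed U)).

Definition sub_sect U : Type := {x : F U | x \in sub_inc U}.
HB.instance Definition _ U := SubChoice.on (sub_sect U).
HB.instance Definition _ U := [SubChoice_isSubZmodule of sub_sect U by <:].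

Lemma sub_resP V U (a : site_hom V U) (x : sub_sect U) :
  restr F a (val x) \in sub_inc V.
Proof. by apply/asboolP/sub_in_res/asboolP/(valP x). Qed.

Definition sub_res_fun V U (a : site_hom V U) (x : sub_sect U) : sub_sect V :=
  exist _ (restr F a (val x)) (sub_resP a x).

Lemma sub_resB V U (a : site_hom V U) : zmod_morphism (sub_res_fun a).
Proof. by move=> x y; apply: val_inj; rewrite /= !raddfB. Qed.

Definition sub_res V U (a : site_hom V U) : {additive sub_sect U -> sub_sect V} :=
  HB.pack (sub_res_fun a)
    (GRing.isZmodMorphism.Build _ _ (sub_res_fun a) (sub_resB a)).

Lemma sub_res_id U x : sub_res (site_id U) x = x.
Proof. by apply: val_inj; rewrite /= restr_id. Qed.

Lemma sub_res_comp W V U (a : site_hom V U) (b : site_hom W V) x :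
  sub_res (site_comp a b) x = sub_res b (sub_res a x).
Proof. by apply: val_inj; rewrite /= restr_comp. Qed.

Definition sub_presheaf : presheaf :=
  @Presheaf (fun U => (sub_sect U : zmodType)) sub_res sub_res_id sub_res_comp.

Lemma sub_is_sheaf : is_sheaf sub_presheaf.
Proof.
move=> V U a x xm.
have vm : matching a (val x : F V).
  by move=> W b c bc; have /(congr1 val) := xm W b c bc.
have [y [yx yuniq]] := sheafP vm.
have yS : y \in sub_inc U.
  apply/asboolP/(sub_in_local (a := a)); rewrite yx; exact/asboolP/(valP x).
exists (exist _ y yS : sub_sect U); split=> [|z zx].
  by apply: val_inj; rewrite /= yx.
by apply: val_inj; apply: yuniq; rewrite -zx.
Qed.

Definition sub_sheaf : sheaf := Sheaf sub_is_sheaf.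

End Subsheaf.

Coercion sub_sheaf : subsheaf >-> sheaf.

Section KernelImage.
Variables (F G : sheaf) (u : psh_hom F G).

Definition kernel_in U (x : F U) : Prop := u U x = 0.

Lemma kernel_in0 U : kernel_in (0 : F U).
Proof. exact: raddf0. Qed.

Lemma kernel_inB U (x y : F U) : kernel_in x -> kernel_in y -> kernel_in (x - y).
Proof. by rewrite /kernel_in raddfB => -> ->; rewrite subrr. Qed.

Lemma kernel_in_res V U (a : site_hom V U) (x : F U) :
  kernel_in x -> kernel_in (restr F a x).
Proof. by rewrite /kernel_in psh_hom_nat => ->; rewrite raddf0. Qed.

Lemma kernel_in_local V U (a : site_hom V U) (x : F U) :
  kernel_in (restr F a x) -> kernel_in x.
Proof.
by rewrite /kernel_in psh_hom_nat => h; apply: (restr_inj (a := a)); rewrite h raddf0.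
Qed.

Definition kernel_sheaf : subsheaf F :=
  Subsheaf kernel_in0 kernel_inB kernel_in_res kernel_in_local.

(* The image in the category of sheaves: the smallest subsheaf of G through which
   [u] factors. *)
Definition image_in U (y : G U) : Prop :=
  forall S : subsheaf G, (forall V (x : F V), S V (u V x)) -> S U y.

Lemma image_in0 U : image_in (0 : G U).
Proof. by move=> S _; apply: sub_in0. Qed.

Lemma image_inB U (x y : G U) : image_in x -> image_in y -> image_in (x - y).
Proof. by move=> hx hy S hS; apply: sub_inB; [apply: hx|apply: hy]. Qed.

Lemma image_in_res V U (a : site_hom V U) (x : G U) :
  image_in x -> image_in (restr G a x).
Proof. by move=> hx S hS; apply/sub_in_res/hx. Qed.

Lemma image_in_local V U (a : site_hom V U) (x : G U) :
  image_in (restr G a x) -> image_in x.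
Proof. by move=> hx S hS; apply: (sub_in_local (a := a)); apply: hx. Qed.

Definition image_sheaf : subsheaf G :=
  Subsheaf image_in0 image_inB image_in_res image_in_local.

End KernelImage.

Section Corestriction.
Variables (F : presheaf) (G : sheaf) (S : subsheaf G) (u : psh_hom F G).
Hypothesis uS : forall U x, S U (u U x).

Lemma corestr_subproof U x : u U x \in sub_inc S U.
Proof. exact/asboolP/uS. Qed.

Definition corestr_fun U (x : F U) : sub_sheaf S U :=
  exist _ (u U x) (corestr_subproof x).

Lemma corestrB U : zmod_morphism (@corestr_fun U).
Proof. by move=> x y; apply: val_inj; rewrite /= raddfB. Qed.

Definition corestr_add U : {additive F U -> sub_sheaf S U} :=
  HB.pack (@corestr_fun U)
    (GRing.isZmodMorphism.Build _ _ (@corestr_fun U) (@corestrB U)).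

Lemma corestr_nat V U (a : site_hom V U) x :
  corestr_add V (restr F a x) = restr (sub_sheaf S) a (corestr_add U x).
Proof. by apply: val_inj; rewrite /= psh_hom_nat. Qed.

Definition corestr : psh_hom F (sub_sheaf S) := PshHom corestr_nat.

End Corestriction.

Section Power.
Variables (n : nat) (F : sheaf).

Definition power_sect U : zmodType := {ffun 'I_n -> F U}.

Definition power_res_fun V U (a : site_hom V U) (x : power_sect U) : power_sect V :=
  [ffun i => restr F a (x i)].

Lemma power_resB V U (a : site_hom V U) : zmod_morphism (power_res_fun a).
Proof. by move=> x y; apply/ffunP => i; rewrite !ffunE raddfB. Qed.

Definition power_res V U (a : site_hom V U) : {additive power_sect U -> power_sect V} :=
  HB.pack (power_res_fun a)
    (GRing.isZmodMorphism.Build _ _ (power_res_fun a) (power_resB a)).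

Lemma power_res_id U x : power_res (site_id U) x = x.
Proof. by apply/ffunP => i; rewrite ffunE restr_id. Qed.

Lemma power_res_comp W V U (a : site_hom V U) (b : site_hom W V) x :
  power_res (site_comp a b) x = power_res b (power_res a x).
Proof. by apply/ffunP => i; rewrite !ffunE restr_comp. Qed.

Definition power_presheaf : presheaf := Presheaf power_res_id power_res_comp.

Lemma power_is_sheaf : is_sheaf power_presheaf.
Proof.
move=> V U a x xm.
have xim i : matching a (x i : F V).
  by move=> W b c bc; have /ffunP/(_ i) := xm W b c bc; rewrite !ffunE.
have [y yP] := choice (fun i => sheafP (xim i)).
exists [ffun i => y i]; split=> [|z zx].
  by apply/ffunP => i; rewrite !ffunE; have [] := yP i.
by apply/ffunP => i; rewrite ffunE; apply: (yP i).2; rewrite -zx ffunE.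
Qed.

Definition sheaf_power : sheaf := Sheaf power_is_sheaf.

Variables (G : sheaf) (u : 'I_n -> psh_hom F G).

Definition power_hom_fun U (x : sheaf_power U) : G U := \sum_i u i U (x i).

Lemma power_homB U : zmod_morphism (@power_hom_fun U).
Proof.
move=> x y; rewrite /power_hom_fun -sumrB; apply: eq_bigr => i _.
by rewrite !ffunE -raddfB.
Qed.

Definition power_hom_add U : {additive sheaf_power U -> G U} :=
  HB.pack (@power_hom_fun U)
    (GRing.isZmodMorphism.Build _ _ (@power_hom_fun U) (@power_homB U)).

Lemma power_hom_nat V U (a : site_hom V U) x :
  power_hom_add V (restr sheaf_power a x) = restr G a (power_hom_add U x).
Proof.
rewrite /= /power_hom_fun raddf_sum; apply: eq_bigr => i _.
by rewrite ffunE psh_hom_nat.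
Qed.

(* (s_1, ..., s_n) |-> u_1 s_1 + ... + u_n s_n *)
Definition power_hom : psh_hom sheaf_power G := PshHom power_hom_nat.

End Power.

(* Monomorphisms of abelian sheaves are the sectionwise injective morphisms. *)
Definition sheaf_mono (F G : sheaf) (u : psh_hom F G) : Prop :=
  forall U, injective (u U).

Definition sheaf_exact (F G H : sheaf) (u : psh_hom F G) (v : psh_hom G H) : Prop :=
  forall U (y : G U), image_sheaf u U y <-> kernel_sheaf v U y.

Definition injective_sheaf (I : sheaf) : Prop :=
  forall (F G : sheaf) (m : psh_hom F G) (u : psh_hom F I), sheaf_mono m ->
  exists v : psh_hom G I, forall U x, v U (m U x) = u U x.

Record injective_resolution (F : sheaf) := InjectiveResolution {
  resol : nat -> sheaf;
  resol_aug : psh_hom F (resol 0);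
  resol_diff : forall n, psh_hom (resol n) (resol n.+1);
  resol_injective : forall n, injective_sheaf (resol n);
  resol_mono : sheaf_mono resol_aug;
  resol_exact0 : sheaf_exact resol_aug (resol_diff 0);
  resol_exactS : forall n, sheaf_exact (resol_diff n) (resol_diff n.+1)
}.

(* Ker (Gamma I^1 -> Gamma I^2) = Im (Gamma I^0 -> Gamma I^1) for every injective
   resolution of F, where Gamma is evaluation at the final object Spec R. *)
Definition H1_vanishes (F : sheaf) : Prop :=
  forall (I : injective_resolution F) (y : resol I 1 X),
    resol_diff I 1 X y = 0 -> exists x : resol I 0 X, resol_diff I 0 X x = y.

Section Modules.

Definition tensor_res (M : lmodType R) V U (a : site_hom V U) :
    {additive tensor (site_str U) M -> tensor (site_str V) M} :=
  tensor_map (idfun : {linear M -> M}) (site_hom_over a).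

Lemma tensor_res_id M U x : tensor_res M (site_id U) x = x.
Proof. by move: x; apply: (tensor_ext (v := idfun)) => m s; rewrite [LHS]tensor_mapE. Qed.

Lemma tensor_res_comp M W V U (a : site_hom V U) (b : site_hom W V) x :
  tensor_res M (site_comp a b) x = tensor_res M b (tensor_res M a x).
Proof.
move: x; apply: (tensor_ext (v := tensor_res M b \o tensor_res M a)) => m s.
rewrite [LHS]tensor_mapE; symmetry.
transitivity (tensor_res M b (tens (site_str V) m (a s))); last exact: tensor_mapE.
by congr (tensor_res M b _); exact: tensor_mapE.
Qed.

Definition tensor_presheaf (M : lmodType R) : presheaf :=
  Presheaf (@tensor_res_id M) (@tensor_res_comp M).

Variables (M N : lmodType R) (u : {linear M -> N}).

Definition tensor_hom_add U : {additive tensor_presheaf M U -> tensor_presheaf N U} :=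
  tensor_map u (v := idfun) (f' := site_str U) (fun=> erefl).

Lemma tensor_hom_nat V U (a : site_hom V U) x :
  tensor_hom_add V (restr (tensor_presheaf M) a x) =
  restr (tensor_presheaf N) a (tensor_hom_add U x).
Proof.
move: x; apply: (tensor_ext (u := tensor_hom_add V \o tensor_res M a)
  (v := tensor_res N a \o tensor_hom_add U)) => m s.
transitivity (tens (site_str V) (u m) (a s)).
  transitivity (tensor_hom_add V (tens (site_str V) m (a s))).
    by congr (tensor_hom_add V _); exact: tensor_mapE.
  exact: tensor_mapE.
symmetry; transitivity (tensor_res N a (tens (site_str U) (u m) s)).
  by congr (tensor_res N a _); exact: tensor_mapE.
exact: tensor_mapE.
Qed.

Definition tensor_hom : psh_hom (tensor_presheaf M) (tensor_presheaf N) :=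
  PshHom tensor_hom_nat.

End Modules.

Definition frob (M : lmodType R) : Type := sheafification (tensor_presheaf M).

Definition frob_hom (M N : lmodType R) (Ms : frob M) (Ns : frob N)
    (u : {linear M -> N}) : psh_hom Ms Ns :=
  shf_map Ms Ns (tensor_hom u).

End Sheaves.

Arguments tensor_hom {p R M N} u.

Definition finitely_generated (R : comNzRingType) (M : lmodType R) : Prop :=
  exists s : seq M, forall m, exists c : 'I_(size s) -> R,
    m = \sum_(i < size s) c i *: s`_i.

Section Syzygies.
Variables (p : nat) (R : comNzRingType).

Section ScaleBy.
Variables (M : lmodType R) (m : M).

Definition scale_by_fun (r : R^o) : M := r *: m.

Lemma scale_by_linear : linear scale_by_fun.
Proof. by move=> a x y; rewrite /scale_by_fun scalerDl scalerA. Qed.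

Definition scale_by : {linear R^o -> M} :=
  HB.pack scale_by_fun
    (GRing.isLinear.Build R R^o M *:%R scale_by_fun scale_by_linear).

End ScaleBy.

Variables (N M : lmodType R) (i : {linear N -> M}) (n : nat).
Variables (f : {linear 'rV[R]_n -> M}).
Hypothesis f_im : forall y, (exists x, f x = y) <-> (exists z, i z = y).
Variables (Os : frob p R^o) (Ns : frob p N) (Ms : frob p M).

(* The morphism O_frob^n -> M_frob induced by [f]. *)
Definition free_hom : psh_hom (sheaf_power n Os) Ms :=
  power_hom (fun j => frob_hom Os Ms (scale_by (f (delta_mx 0 j)))).

Lemma scale_by_image z U (s : Os U) :
  image_sheaf (frob_hom Ns Ms i) U (frob_hom Os Ms (scale_by (i z)) U s).
Proof.
have -> : frob_hom Os Ms (scale_by (i z)) U s =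
    psh_comp (frob_hom Ns Ms i) (frob_hom Os Ns (scale_by z)) U s.
  apply: shf_lift_uniq => V x.
  transitivity (shf_unit Ms V (tensor_hom (scale_by (i z)) V x)).
    exact: shf_liftE.
  symmetry; transitivity
      (frob_hom Ns Ms i V (shf_unit Ns V (tensor_hom (scale_by z) V x))).
    by congr (frob_hom Ns Ms i V _); exact: shf_liftE.
  transitivity
      (shf_unit Ms V (tensor_hom i V (tensor_hom (scale_by z) V x))).
    exact: shf_liftE.
  congr (shf_unit Ms V _); move: x.
  apply: (tensor_ext (u := tensor_hom i V \o tensor_hom (scale_by z) V)) => r t.
  transitivity (tensor_hom i V (tens (site_str V) (scale_by z r) t)).
    by congr (tensor_hom i V _); exact: tensor_mapE.
  transitivity (tens (site_str V) (i (scale_by z r)) t); first exact: tensor_mapE.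
  symmetry; transitivity (tens (site_str V) (scale_by (i z) r) t).
    exact: tensor_mapE.
  by congr tens; rewrite /= /scale_by_fun linearZ.
by move=> S hS; exact: hS.
Qed.

Lemma free_hom_image U (s : sheaf_power n Os U) :
  image_sheaf (frob_hom Ns Ms i) U (free_hom U s).
Proof.
set S := image_sheaf _; rewrite /free_hom /= /power_hom_fun.
apply: (big_ind (S U)) => [|x y hx hy|j _].
- exact: (sub_in0 S U).
- rewrite -[y]opprK -[- y]sub0r; apply: (sub_inB hx).
  by apply: (sub_inB _ hy); exact: (sub_in0 S U).
- have [z <-] := (f_im (f (delta_mx 0 j))).1 (ex_intro _ _ erefl).
  exact: scale_by_image.
Qed.

(* Kernel of O_frob^n -> N^frob. *)
Definition syz : subsheaf (sheaf_power n Os) :=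
  kernel_sheaf (corestr free_hom_image).

End Syzygies.

(* Main.v *)
(** Every sheaf on the Frobenius site is constant, so taking global sections is an
    equivalence from abelian sheaves to abelian groups and every [H^1] vanishes.
    Indeed a cover V -> U is purely inseparable in a uniform sense: some power
    [v ^+ (p ^ e)] of every function on V comes from U.  Hence any two morphisms
    W -> V over U agree after the [e]-th Frobenius of W, that is on the cover of W
    given by the subring of [p ^ e]-th powers of its coordinate ring.  As restriction
    to this cover is injective for a sheaf, every section over V is a matching family
    for V -> U, so restriction from U to V is bijective. *)
From HB Require Import structures.
Require Import Defs.
From mathcomp Require Import all_boot all_order all_algebra ring_quotient.
From mathcomp Require Import boolp classical_sets.

Set Implicit Arguments.
Unset Strict Implicit.
Unset Printing Implicit Defensive.
Import GRing.Theory.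
Local Open Scope ring_scope.

(** * Primes avoiding a non-nilpotent element *)

Section Nilpotent.
Variables (A : comNzRingType) (v : A).

(** Membership of 0 is left out so that the empty set, the union of the empty chain in Zorn's lemma,
    qualifies. *)
Let avoids (I : set A) : Prop :=
  (forall n, ~ I (v ^+ n)) /\ (forall a x y, I x -> I y -> I (a * x + y)).

(** An ideal maximal among those containing no power of [v] is prime. *)
Lemma exists_prime_avoiding_powers : (forall n, v ^+ n != 0) ->
  exists Q : {pred A}, [/\ idealr_closed Q, prime_idealr_closed Q & v \notin Q].
Proof.
move=> vn0.
have [|I [[Iv Ilin] Imax]] := @Zorn_bigcup _ avoids.
  move=> F FP Ftot; split=> [n [J FJ Jv]|a x y [J FJ Jx] [K FK Ky]].
    by have [] := FP J FJ => /(_ n).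
  have [JK|KJ] := Ftot J K FJ FK.
    by exists K => //; apply: (FP K FK).2 => //; apply: JK.
  by exists J => //; apply: (FP J FJ).2 => //; apply: KJ.
(* A maximal [I] without 0 would be empty, and the zero ideal, which avoids the powers of [v], would
   enlarge it. *)
have I0 : I 0.
  apply: contrapT => nI0.
  have Iempty x : ~ I x.
    by move=> Ix; apply: nI0; have := Ilin (-1) x x Ix Ix; rewrite mulN1r addNr.
  apply: (Imax [set 0]%classic).
    by split=> [x /Iempty//|/(_ 0 erefl)/nI0].
  split=> [n /= /eqP|a x y /= -> ->]; first by rewrite (negPf (vn0 n)).
  by rewrite mulr0 addr0.
have IM a x : I x -> I (a * x) by move=> Ix; rewrite -[_ * _]addr0; apply: Ilin.
have ID x y : I x -> I y -> I (x + y).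
  by move=> Ix Iy; rewrite -[x]mul1r; apply: Ilin.
(* Otherwise the ideal [A x + I] would contradict the maximality of [I]. *)
have hit x : ~ I x -> exists n a y, I y /\ v ^+ n = a * x + y.
  move=> nIx; apply: contrapT => nhit.
  apply: (Imax [set z | exists a y, I y /\ z = a * x + y]%classic).
    split=> [y Iy|sub]; first by exists 0, y; rewrite mul0r add0r.
    by apply/nIx/sub; exists 1, 0; rewrite mul1r addr0.
  split=> [n [a [y [Iy E]]]|b _ _ [a [y [Iy ->]]] [a' [y' [Iy' ->]]]].
    by apply: nhit; exists n, a, y.
  exists (b * a + a'), (b * y + y'); split; first exact: Ilin.
  by rewrite mulrDl mulrDr mulrA addrACA.
have inQ x : (x \in (fun z => `[< I z >] : bool)) = `[< I x >] by [].
exists (fun x => `[< I x >]); split; last by apply/asboolP; rewrite -[v]expr1.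
  split=> [||a x y]; first exact/asboolP.
    by apply/asboolP; rewrite -[1](expr0 v).
  by rewrite !inQ => /asboolP Ix /asboolP Iy; apply/asboolP/Ilin.
move=> x y; rewrite !inQ => /asboolP Ixy; apply: contrapT.
move=> /negP; rewrite negb_or => /andP[/asboolP/hit Hx /asboolP/hit Hy].
have [[n [a [i [Ii Ex]]]] [m [b [j [Ij Ey]]]]] := (Hx, Hy).
apply: (Iv (n + m)%N); rewrite exprD Ex Ey mulrDl mulrDr.
apply: (ID _ _); last by rewrite mulrC; apply: IM.
by apply: (ID _ _); [rewrite mulrACA; apply: (IM _ _)|apply: (IM _ _)].
Qed.

End Nilpotent.

(** Each prime of [B] is the preimage of a prime of [A], so it contains the kernel of [g]; an
    element of all primes is nilpotent. *)
Lemma spec_surjective_ker_nil (A B : comNzRingType) (g : {rmorphism B -> A}) v :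
  spec_surjective g -> g v = 0 -> exists n, v ^+ n = 0.
Proof.
move=> gs gv0; apply: contrapT => vnil.
have vn0 n : v ^+ n != 0 by apply/eqP => vn; apply: vnil; exists n.
have [Q [Q0 Q1 /negP vQ]] := exists_prime_avoiding_powers vn0.
have [P [[P0 _ _] _ QP]] := gs Q Q0 Q1.
by apply: vQ; rewrite QP gv0.
Qed.

(** * The Frobenius cover onto the subring of powers *)

Section FrobeniusPower.
Variables (p : nat) (W : comNzRingType).
Hypothesis pcharW : p \in [pchar W].
Variable e : nat.

Definition frob_pow_fun (x : W) : W := x ^+ (p ^ e).

Lemma frob_powB : zmod_morphism frob_pow_fun.
Proof.
have pn : ([pchar W]).-nat (p ^ e)%N.
  by rewrite pnatX pnatE ?pcharW ?(pcharf_prime pcharW).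
move=> x y; apply/eqP; rewrite eq_sym subr_eq /frob_pow_fun.
by rewrite -exprDn_pchar // subrK.
Qed.

Lemma frob_pow_monoid : monoid_morphism frob_pow_fun.
Proof. by split=> [|x y]; rewrite /frob_pow_fun ?expr1n ?exprMn. Qed.

Definition frob_pow : {rmorphism W -> W} :=
  HB.pack frob_pow_fun
    (GRing.isZmodMorphism.Build _ _ frob_pow_fun frob_powB)
    (GRing.isMonoidMorphism.Build _ _ frob_pow_fun frob_pow_monoid).

Lemma frob_powE x : frob_pow x = x ^+ (p ^ e).
Proof. by []. Qed.

Definition frob_image : {pred W} := fun x => `[< exists w, frob_pow w = x >].

Lemma frob_image_subring : subring_closed frob_image.
Proof.
have inE x : (x \in frob_image) = `[< exists w, frob_pow w = x >] by [].
split=> [|x y|x y]; rewrite !inE; first by apply/asboolP; exists 1; rewrite rmorph1.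
  move=> /asboolP[x' <-] /asboolP[y' <-]; apply/asboolP.
  by exists (x' - y'); rewrite rmorphB.
move=> /asboolP[x' <-] /asboolP[y' <-]; apply/asboolP.
by exists (x' * y'); rewrite rmorphM.
Qed.

HB.instance Definition _ :=
  GRing.isSubringClosed.Build W frob_image frob_image_subring.

Definition frob_ring := {x : W | x \in frob_image}.
HB.instance Definition _ := SubChoice.on frob_ring.
HB.instance Definition _ := [SubChoice_isSubComNzRing of frob_ring by <:].

Lemma frob_corestr_subproof x : frob_pow x \in frob_image.
Proof. by apply/asboolP; exists x. Qed.

Definition frob_corestr_fun (x : W) : frob_ring :=
  exist _ (frob_pow x) (frob_corestr_subproof x).

Lemma frob_corestrB : zmod_morphism frob_corestr_fun.
Proof. by move=> x y; apply: val_inj; exact: (rmorphB frob_pow). Qed.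

Lemma frob_corestr_monoid : monoid_morphism frob_corestr_fun.
Proof.
split=> [|x y]; apply: val_inj; first exact: (rmorph1 frob_pow).
exact: (rmorphM frob_pow).
Qed.

(** Corestriction makes the map surjective, hence finite; [frob_pow] as a map from [W] to itself
    need not be finite. *)
Definition frob_corestr : {rmorphism W -> frob_ring} :=
  HB.pack frob_corestr_fun
    (GRing.isZmodMorphism.Build _ _ frob_corestr_fun frob_corestrB)
    (GRing.isMonoidMorphism.Build _ _ frob_corestr_fun frob_corestr_monoid).

Lemma val_frob_corestr x : val (frob_corestr x) = x ^+ (p ^ e).
Proof. by []. Qed.

Lemma frob_corestr_val (z : frob_ring) : frob_corestr (val z) = z ^+ (p ^ e).
Proof. by apply: val_inj; rewrite val_frob_corestr rmorphXn. Qed.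

(** The inclusion [val] completes the factorization. A prime [Q] of the subring lies under its
    preimage along [frob_corestr], because [z] and its [p ^ e]-th power lie in the same primes. *)
Lemma frob_corestr_cover : finite_frobenius_cover p frob_corestr.
Proof.
split.
  exists [:: 1] => z; have /asboolP[w wz] := valP z.
  by exists (fun=> w); rewrite big_ord1 /= mulr1; apply: val_inj; rewrite /= -wz.
exists e, (val : {rmorphism frob_ring -> W}); split=> // Q [Q0 Q1 Ql] Qp.
have QX z : (z \in Q) = (z ^+ (p ^ e) \in Q).
  have : (0 < p ^ e)%N by rewrite expn_gt0 prime_gt0 // (pcharf_prime pcharW).
  elim: (p ^ e)%N => // n IHn _; rewrite exprS; apply/idP/idP => [zQ|/Qp/orP[]//].
    by rewrite mulrC -[_ * z]addr0 Ql.
  by case: n IHn => [|n ->] //; rewrite expr0 (negPf Q1).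
exists (fun w => frob_corestr w \in Q); split.
- split=> [||a x y]; rewrite /in_mem /=.
  + by rewrite -[frob_corestr_fun]/(frob_corestr : _ -> _) rmorph0.
  + by rewrite -[frob_corestr_fun]/(frob_corestr : _ -> _) rmorph1.
  + rewrite -[frob_corestr_fun]/(frob_corestr : _ -> _) rmorphD rmorphM.
    exact: Ql.
- move=> x y; rewrite /in_mem /= -[frob_corestr_fun]/(frob_corestr : _ -> _).
  by rewrite rmorphM; apply: Qp.
- by move=> z; rewrite QX -frob_corestr_val.
Qed.

End FrobeniusPower.

(** The difference of [a (g v)] and [v ^+ (p ^ d)] is killed by [g], hence nilpotent, so a further
    Frobenius power of [v] lies in the image of [a], where [b] and [c] agree. Finiteness of [a]
    makes the exponent uniform. *)
Lemma cover_pow_eq (p : nat) (U V W : comNzRingType) (a : {rmorphism U -> V})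
    (b c : {rmorphism V -> W}) :
  p \in [pchar V] -> finite_frobenius_cover p a ->
  (forall u, b (a u) = c (a u)) ->
  exists e, forall v, b v ^+ (p ^ e) = c v ^+ (p ^ e).
Proof.
move=> pV [[s sP] [d [g [gK gs]]]] bc.
have pW : p \in [pchar W] := rmorph_pchar b pV.
have p_gt1 : (1 < p)%N := prime_gt1 (pcharf_prime pV).
have powV v : exists n, v ^+ (p ^ (d + n)) = a (g v ^+ (p ^ n)).
  have [||n vn] := @spec_surjective_ker_nil _ _ g (a (g v) - v ^+ (p ^ d)) => //.
    by rewrite rmorphB rmorphXn gK subrr.
  (* The nilpotency exponent also serves as Frobenius exponent, since [n < p ^ n]. *)
  exists n; apply/eqP; rewrite eq_sym -subr_eq0 expnD exprM rmorphXn.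
  rewrite -!(frob_powE pV n) -rmorphB frob_powE.
  by rewrite -(subnK (ltnW (ltn_expl n p_gt1))) exprD vn mulr0.
have [n nP] := choice powV.
(* By additivity of Frobenius it suffices to treat the generators, and the largest of their
   exponents works for all. *)
pose m := \max_(i < size s) n (s`_i)%R; exists (d + m)%N => v.
have [k ->] := sP v; rewrite !rmorph_sum -!(frob_powE pW) !rmorph_sum.
apply: eq_bigr => i _; rewrite !rmorphM bc; congr (_ * _).
have -> : (d + m = (d + n (s`_i)%R) + (m - n (s`_i)%R))%N.
  by rewrite -addnA subnKC // (@leq_bigmax _ (fun i : 'I_(size s) => n (s`_i)%R)).
rewrite !frob_powE [(p ^ _)%N]expnD !exprM; congr (_ ^+ _).
by rewrite -!rmorphXn nP bc.
Qed.

(** * Constancy of sheaves and vanishing of cohomology *)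

Section ConstantSheaves.
Variables (p : nat) (R : comNzRingType).
Hypothesis pcharR : p \in [pchar R].
Notation site := (site p R).

Lemma site_pchar (U : site) : p \in [pchar U].
Proof. exact: (rmorph_pchar (site_str U)). Qed.

Lemma rmorphism_eq (A B : comNzRingType) (b c : {rmorphism A -> B}) :
  b =1 c -> b = c.
Proof.
case: b c => b [[b1] [b2]] [c [[c1] [c2]]] /= /funext E.
case: _ / E c1 c2 => c1 c2.
by rewrite (Prop_irrelevance c1 b1) (Prop_irrelevance c2 b2).
Qed.

Lemma site_hom_eq (V U : site) (b c : site_hom V U) : b =1 c -> b = c.
Proof.
case: b c => b b1 b2 [c c1 c2] /= /rmorphism_eq E.
case: _ / E c1 c2 => c1 c2.
by rewrite (Prop_irrelevance c1 b1) (Prop_irrelevance c2 b2).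
Qed.

Definition frob_site (W : site) (e : nat) : site :=
  @SiteObj p R (frob_ring (site_pchar W) e)
    (frob_corestr (site_pchar W) e \o site_str W : {rmorphism R -> _})
    (finite_frobenius_cover_comp (site_strP W) (frob_corestr_cover _ e)).

Definition frob_site_hom (W : site) (e : nat) : site_hom (frob_site W e) W :=
  @SiteHom p R (frob_site W e) W (frob_corestr (site_pchar W) e) (fun=> erefl)
    (frob_corestr_cover _ e).

Lemma sheaf_matching (F : sheaf p R) (V U : site) (a : site_hom V U) (x : F V) :
  matching a x.
Proof.
move=> W b c abc.
have bc u : b (a u) = c (a u).
  exact: (congr1 (fun h : site_hom W U => h u) abc).
have [e eP] := cover_pow_eq (site_pchar V) (site_homP a) bc.
apply: (restr_inj (a := frob_site_hom W e)); rewrite -!restr_comp.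
(* On the cover by powers both composites send [v] to the same [p ^ e]-th power. *)
congr (restr F _ x); apply: site_hom_eq => v; apply: val_inj; exact: eP.
Qed.

Lemma restr_surj (F : sheaf p R) (V U : site) (a : site_hom V U) (x : F V) :
  exists y, restr F a y = x.
Proof. by have [y [yx _]] := sheafP (@sheaf_matching F V U a x); exists y. Qed.

Section SectionwiseImage.
Variables (F G : sheaf p R) (u : psh_hom F G).

Let img U (y : G U) : Prop := exists x, u U x = y.

Lemma sectionwise_image0 U : img (0 : G U).
Proof. by exists 0; rewrite raddf0. Qed.

Lemma sectionwise_imageB U (x y : G U) : img x -> img y -> img (x - y).
Proof. by move=> [x' <-] [y' <-]; exists (x' - y'); rewrite raddfB. Qed.

Lemma sectionwise_image_res V U (a : site_hom V U) (x : G U) :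
  img x -> img (restr G a x).
Proof. by move=> [x' <-]; exists (restr F a x'); rewrite psh_hom_nat. Qed.

(** A preimage over [V] descends to [U] by [restr_surj], so the presheaf image is already a
    subsheaf. *)
Lemma sectionwise_image_local V U (a : site_hom V U) (y : G U) :
  img (restr G a y) -> img y.
Proof.
move=> [x ux]; have [x' x'x] := restr_surj a x; exists x'.
by apply: (restr_inj (a := a)); rewrite -psh_hom_nat x'x.
Qed.

(** The image sheaf is the smallest subsheaf receiving [u], hence lies in the sectionwise image. *)
Lemma image_sheafE U (y : G U) : image_sheaf u U y -> exists x, u U x = y.
Proof.
pose S := Subsheaf sectionwise_image0 sectionwise_imageB
  sectionwise_image_res sectionwise_image_local.
by move=> /(_ S); apply=> V x; exists x.
Qed.

End SectionwiseImage.

(** Exactness of the resolution puts a cocycle in the image sheaf, and over [Spec R] this image is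
    sectionwise. *)
Lemma H1_vanishes_frob (F : sheaf p R) : H1_vanishes F.
Proof. by move=> I y dy; apply: image_sheafE; apply: (resol_exactS y).2. Qed.

End ConstantSheaves.

Theorem corollary4p5p2 (R : comNzRingType) (p : nat) (k : fieldType)
    (pchar_k : p \in [pchar k]) (k_in_R : {rmorphism k -> R}) :
  (forall (N M L : lmodType R) (i : {linear N -> M}) (q : {linear M -> L}),
     injective i ->
     (forall m, q m = 0 <-> exists x, i x = m) ->
     (forall l, exists m, q m = l) ->
     forall (Ms : frob p M) (Ls : frob p L),
       H1_vanishes (kernel_sheaf (frob_hom Ms Ls q)))
  /\
  (forall (N M : lmodType R) (i : {linear N -> M}),
     injective i -> finitely_generated N -> finitely_generated M ->
     forall (n : nat) (f : {linear 'rV[R]_n -> M})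
       (f_im : forall y, (exists x, f x = y) <-> (exists z, i z = y))
       (Os : frob p R^o) (Ns : frob p N) (Ms : frob p M),
       H1_vanishes (syz f_im Os Ns Ms)).
Proof.
have pcharR := rmorph_pchar k_in_R pchar_k.
by split=> *; apply: H1_vanishes_frob.
Qed.
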